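(* Let $X$ and $Y$ be Banach spaces and let $T:X\to Y$ be an operator. The following statements are equivalent: (1) $T$ is Dunford-Pettis. (2) $Tf=T\circ f$ is Riemann integrable for every weakly continuous function $f:[0,1]\to X$. (3) $Tf=T\circ f$ is Riemann integrable for every scalarly Riemann integrable function $f:[0,1]\to X$.
   Context: All Banach spaces are real; an operator is a continuous linear map between Banach spaces. An operator is Dunford-Pettis (completely continuous) if it carries weakly null sequences to norm null sequences. A function $f:[0,1]\to X$ is scalarly Riemann integrable if $x^*\circ f$ is Riemann integrable for every $x^*\in X^*$. Weakly continuous means continuous from $[0,1]$ to $X$ with its weak topology. A tagged partition of $[0,1]$ is a finite collection $\mathcal P=\{(s_i,[t_{i-1},t_i]):1\le i\le N\}$, where the $[t_{i-1},t_i]$ are non-overlapping closed intervals covering $[0,1]$ and $s_i\in(t_{i-1},t_i)$; its norm is $\max_i(t_i-t_{i-1})$, and for a function $g$ from $[0,1]$ into a Banach space $Z$ one puts $g(\mathcal P)=\sum_{i=1}^N (t_i-t_{i-1})g(s_i)$. Such a $g$ is Riemann integrable, with integral $z\in Z$, if for every $\varepsilon>0$ there is $\delta>0$ such that $\|g(\mathcal P)-z\|<\varepsilon$ for all tagged partitions $\mathcal P$ of $[0,1]$ with norm less than $\delta$. *)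

(* Defs.v *)
From HB Require Import structures.
From mathcomp Require Import all_boot all_order all_algebra.
From mathcomp Require Import all_classical all_reals all_analysis.
Set Implicit Arguments.
Unset Strict Implicit.
Unset Printing Implicit Defensive.
Import Order.TTheory GRing.Theory Num.Theory.
Import numFieldNormedType.Exports.
Local Open Scope classical_set_scope.
Local Open Scope ring_scope.

(** The dual [X^*]: the continuous linear functionals on [X]. *)
Record dual (R : realType) (X : normedModType R) := Dual {
  dual_fun :> {linear X -> R^o};
  dual_continuous : continuous dual_fun }.

(** [X] with its weak topology, the coarsest one for which every element of
    the dual is continuous. *)
Definition weak (R : realType) (X : normedModType R) : topologicalType :=
  sup_topology (fun xs : dual X => Topological.on (initial_topology xs)).

Definition weakly_cvg (R : realType) (X : normedModType R)
    (u : nat -> weak X) (x : weak X) : Prop := u @ \oo --> x.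

Definition dunford_pettis (R : realType) (X Y : normedModType R)
    (T : {linear X -> Y}) : Prop :=
  forall u : nat -> X, weakly_cvg u (0 : X) -> T \o u @ \oo --> (0 : Y).

(** A function on [[0, 1]] is represented by a function on [R], of which only
    the values on [[0, 1]] are ever used. *)
Definition weakly_continuous (R : realType) (X : normedModType R)
    (f : R -> weak X) : Prop :=
  {within `[0, 1], continuous f}.

(** [points] lists [t_1 < ... < t_N = 1]; since [t_0 = 0] is left out, the
    [i]-th interval, counting from 0, is [[(0 :: points)`_i, points`_i]]. *)
Record tagged_partition (R : realType) := TaggedPartition {
  points : seq R;
  tags : seq R;
  points_partition : itv_partition 0 1 points;
  size_tags : size tags = size points;
  tag_in : forall i, (i < size points)%N ->
    (0 :: points)`_i < tags`_i < points`_i }.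

Definition width (R : realType) (P : tagged_partition R) (i : nat) : R :=
  (points P)`_i - (0 :: points P)`_i.

Definition mesh (R : realType) (P : tagged_partition R) : R :=
  \big[Num.max/0]_(i < size (points P)) width P i.

Definition riemann_sum (R : realType) (Z : normedModType R) (g : R -> Z)
    (P : tagged_partition R) : Z :=
  \sum_(i < size (points P)) width P i *: g (tags P)`_i.

Definition riemann_integrable (R : realType) (Z : normedModType R)
    (g : R -> Z) : Prop :=
  exists z : Z, forall eps : R, 0 < eps -> exists2 delta : R, 0 < delta &
    forall P : tagged_partition R,
      mesh P < delta -> `|riemann_sum g P - z| < eps.

Definition scalarly_riemann_integrable (R : realType) (X : normedModType R)
    (f : R -> X) : Prop :=
  forall xs : dual X, riemann_integrable (xs \o f : R -> R^o).

(* Main.v *)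
(* A Dunford-Pettis operator turns scalar integrability into integrability:
   if [T \o f] failed the Cauchy criterion, the differences of Riemann sums of
   [f] along finer and finer partitions would be weakly null without having norm
   null images. A continuous scalar function is Riemann integrable, so weakly
   continuous functions are scalarly Riemann integrable.

   Conversely let [u] be weakly null. Remove from [0, 1] the gaps of a Cantor
   set of positive measure, and let [f] be [u n] times a tent function on every gap
   of generation [n], and [0] elsewhere. Since [x^* (u n)] tends to [0], [f] is
   weakly continuous. All the gaps of one generation carry the same vector, so
   moving the tags from the gap centres to gap endpoints changes the Riemann sum
   over the cells of generation [n] by [c *: u n] with [c >= 1 / 2]. If [T \o f]
   is Riemann integrable, this forces [T (u n)] to tend to [0]. *)
Require Import Defs.
From mathcomp Require Import all_boot all_order all_algebra.
From mathcomp Require Import all_classical all_reals all_analysis.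
From mathcomp Require Import ring lra zify.
Import Order.TTheory GRing.Theory Num.Theory.
Import numFieldNormedType.Exports.
Local Open Scope classical_set_scope.
Local Open Scope ring_scope.

(** * Convergence in the weak topology *)

(** Convergence for a supremum of topologies is convergence for each of them, and the topology
    induced by [xs] has preimages under [xs] as its open sets. *)
Lemma cvg_weakP (R : realType) (X : normedModType R) (F : set_system (weak X))
    (FF : Filter F) (x : weak X) :
  F --> x <-> forall xs : dual X, (xs : weak X -> R^o) @ F --> xs x.
Proof.
rewrite cvg_sup; split=> cvF xs.
  apply: cvg_comp; first exact: (cvF xs).
  exact: (@initial_continuous _ _ (xs : X -> R^o)).
move=> A /= [_ [[B Bop <-] Bx sBA]].
rewrite nbhs_filterE; apply: filterS sBA _.
by apply: (cvF xs); exact: open_nbhs_nbhs.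
Qed.

(** * Riemann sums and scalar integrals *)

Section RiemannSums.
Context {R : realType}.
Implicit Types P : tagged_partition R.

Lemma width_gt0 P i : (i < size (points P))%N -> 0 < width P i.
Proof.
by move=> /tag_in/andP[a b]; rewrite subr_gt0 (lt_trans a b).
Qed.

Lemma last_points P : (0 :: points P)`_(size (points P)) = 1.
Proof. exact: itv_partition_nth_size (points_partition P). Qed.

Lemma sum_increments (G : R -> R) P :
  \sum_(i < size (points P)) (G (points P)`_i - G (0 :: points P)`_i) =
  G 1 - G 0.
Proof.
rewrite -(last_points P) -[in RHS]/(G (0 :: points P)`_0).
by rewrite -(telescope_sumr (fun i => G (0 :: points P)`_i)) // big_mkord.
Qed.

Lemma sum_width P : \sum_(i < size (points P)) width P i = 1.
Proof. by rewrite (sum_increments id) subr0. Qed.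

Lemma width_le_mesh P i : (i < size (points P))%N -> width P i <= mesh P.
Proof.
by move=> iP; rewrite /mesh; apply: (le_bigmax _ _ (Ordinal iP)).
Qed.

Lemma points_ge0 P i : (i < size (points P))%N -> 0 <= (0 :: points P)`_i.
Proof.
move=> iP; rewrite (set_nth_default 1) ?ltnS ?(ltnW iP) //.
by apply: itv_partition_nth_ge (points_partition P); rewrite ltnS ltnW.
Qed.

Lemma points_le1 P i : (i < size (points P))%N -> (points P)`_i <= 1.
Proof.
move=> iP; rewrite (set_nth_default 1) //.
exact: (@itv_partition_nth_le _ _ 0 _ _ i.+1 _ (points_partition P)).
Qed.

Lemma linear_riemann_sum (Y Z : normedModType R) (T : {linear Y -> Z})
    (f : R -> Y) P : riemann_sum (T \o f) P = T (riemann_sum f P).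
Proof.
by rewrite /riemann_sum linear_sum; apply: eq_bigr => i _; rewrite linearZ.
Qed.

(** The tags stay free inside equal intervals: two such partitions differing only in their tags are
    compared later. *)
Lemma uniform_partition_exists (N : nat) (t : nat -> R) : (0 < N)%N ->
  (forall k, (k < N)%N -> k%:R / N%:R < t k < k.+1%:R / N%:R) ->
  exists P, mesh P <= N%:R^-1 /\
    forall (Z : normedModType R) (g : R -> Z),
      riemann_sum g P = N%:R^-1 *: \sum_(k < N) g (t k).
Proof.
move=> N0 tN.
have N0' : (0 : R) < N%:R by rewrite ltr0n.
pose p : seq R := mkseq (fun k => k.+1%:R / N%:R) N.
have pE i : (i <= N)%N -> (0 :: p)`_i = i%:R / N%:R.
  by case: i => [|i] iN /=; rewrite ?mul0r // nth_mkseq.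
have sp : size p = N by rewrite size_mkseq.
have pp : itv_partition 0 1 p.
  split; last by rewrite (last_nth 0) sp pE // divff // gt_eqF.
  apply/(pathP 0) => i; rewrite sp => iN.
  rewrite pE ?(ltnW iN) // nth_mkseq //.
  by rewrite ltr_pM2r ?invr_gt0 // ltr_nat.
have st : size (mkseq t N) = size p by rewrite !size_mkseq.
have tp i : (i < size p)%N -> (0 :: p)`_i < (mkseq t N)`_i < p`_i.
  by rewrite sp => iN; rewrite pE ?(ltnW iN) // !nth_mkseq // tN.
pose P := TaggedPartition pp st tp.
have wP i : (i < N)%N -> width P i = N%:R^-1.
  move=> iN; rewrite /width /= pE ?(ltnW iN) // nth_mkseq //.
  by rewrite -mulrBl -natrB // subSnn mul1r.
exists P; split.
  apply: bigmax_le; first by rewrite invr_ge0 ltW.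
  by move=> [i iP] _ /=; rewrite wP // -sp.
move=> Z g; rewrite /riemann_sum /= sp scaler_sumr.
by apply: eq_bigr => i _; rewrite wP // nth_mkseq.
Qed.

Lemma fine_partition_exists (delta : R) : 0 < delta ->
  exists P, mesh P < delta.
Proof.
move=> d0; have [n] := ltr_add_invr d0.
rewrite add0r => nd.
pose t (k : nat) : R := (k%:R + 2^-1) / n.+1%:R.
have [] := @uniform_partition_exists n.+1 t.
- by [].
- by move=> k kn; rewrite /t !ltr_pM2r ?invr_gt0 ?ltr0n // -[k.+1%:R]natr1; lra.
- by move=> P [mP _]; exists P; apply: le_lt_trans nd.
Qed.

(** Sums along partitions of mesh below [n.+1%:R^-1] form a Cauchy sequence; its limit is the
    integral. *)
Lemma riemann_integrable_cauchy (Z : completeNormedModType R) (g : R -> Z) :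
  (forall eps, 0 < eps -> exists2 delta, 0 < delta & forall P Q,
    mesh P < delta -> mesh Q < delta ->
    `|riemann_sum g P - riemann_sum g Q| < eps) ->
  riemann_integrable g.
Proof.
move=> gC.
have /choice[P meshP] : forall n, exists P, mesh P < n.+1%:R^-1.
  by move=> n; apply: fine_partition_exists; rewrite invr_gt0 ltr0n.
have meshP_lt delta : 0 < delta -> \forall n \near \oo, mesh (P n) < delta.
  move=> d0; have [n nd] := ltr_add_invr d0; rewrite add0r in nd.
  exists n => // m /= nm; apply: (lt_trans (meshP m)); apply: le_lt_trans nd.
  by rewrite lef_pV2 ?posrE ?ltr0n // ler_nat.
have /cauchy_cvgP/cvg_ex[z /= gz] :
    cauchy ((fun n => riemann_sum g (P n)) @ \oo).
  apply: cauchy_exP => e e0; have [d d0 dP] := gC _ e0.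
  have [n _ nd] := meshP_lt _ d0; exists (riemann_sum g (P n)).
  exists n => // m /= nm; rewrite -ball_normE /=.
  by apply: dP; apply: nd => /=.
exists z => eps eps0; have eps20 : 0 < eps / 2 by rewrite divr_gt0.
have [d d0 dP] := gC _ eps20; exists d => // Q Qd.
near \oo => n.
rewrite (splitr eps) -(subrK (riemann_sum g (P n)) (riemann_sum g Q)) -addrA.
apply: (le_lt_trans (ler_normD _ _)); apply: ltrD.
  by apply: dP => //; near: n; exact: meshP_lt.
by near: n; move/cvgrPdistC_lt : gz; apply.
Unshelve. all: by end_near. Qed.

(* By the mean value theorem, an antiderivative [G] of [g] gives for each
   partition a choice of tags whose Riemann sum is exactly [G 1 - G 0]. *)
Lemma continuous_riemann_integrable (g : R -> R) :
  continuous g -> riemann_integrable (g : R -> R^o).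
Proof.
(* Starting at [-1] makes [G] differentiable at 0 and 1 as well. *)
move=> gc; pose G (x : R) := \int[@lebesgue_measure R]_(t in `[(-1)%R, x]) g t.
have G' (x : R) : -1 < x < 2 -> is_derive x 1 G (g x).
  move=> /andP[x1 x2].
  have gi : (@lebesgue_measure R).-integrable `[-1, 2] (EFin \o g).
    apply: continuous_compact_integrable; first exact: segment_compact.
    exact: continuous_subspaceT.
  have [dG <-] := continuous_FTC1_closed x2 gi x1 (gc x).
  by rewrite derive1E; exact: derivableP.
exists (G 1 - G 0) => eps eps0.
have eps20 : 0 < eps / 2 by rewrite divr_gt0.
(* Uniform continuity by compactness, using half of each local radius. *)
have [d d0 gd] : exists2 d, 0 < d & forall x y, 0 <= x <= 1 ->
    `|y - x| < d -> `|g y - g x| < eps / 2.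
  have gK : \forall d \near (0 : R)^'+, `[0, 1]%classic `<=`
      (fun x => forall y, `|y - x| < d -> `|g y - g x| < eps / 2).
    move/compact_near_coveringP : (@segment_compact R 0 1); apply.
    move=> x _; have /cvgrPdist_lt/(_ (eps / 2 / 2)) := gc x.
    move=> /(_ (divr_gt0 eps20 (ltr0Sn _ 1)))[r /= r0 gr].
    exists (ball x (r / 2), [set d | d < r / 2]).
      split; first by apply: nbhsx_ballx; rewrite divr_gt0.
      by apply: nbhs_right_lt; rewrite divr_gt0.
    move=> [x' d'] /= [xx' d'r] y yx'.
    have xy : `|x - y| < r.
      rewrite (splitr r) -(subrK x' x) -addrA (le_lt_trans (ler_normD _ _))//.
      by rewrite ltrD // distrC (lt_trans yx').
    have xx'r : `|x - x'| < r by apply: (lt_trans xx'); lra.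
    rewrite (splitr (eps / 2)) -(subrK (g x) (g y)) -addrA.
    rewrite (le_lt_trans (ler_normD _ _)) // ltrD // ?gr // distrC.
    exact: gr.
  near (0 : R)^'+ => d; exists d => [|x y x01 xy].
    by near: d; exact: nbhs_right_gt.
  have gdK : `[0, 1]%classic `<=`
      (fun x => forall y, `|y - x| < d -> `|g y - g x| < eps / 2).
    by near: d; exact: gK.
  by apply: gdK => //=; rewrite in_itv.
exists d => // P Pd.
rewrite -(sum_increments G P) /riemann_sum -sumrB.
apply: (@le_lt_trans _ _ (\sum_(i < size (points P)) width P i * (eps / 2))).
  rewrite (le_trans (ler_norm_sum _ _ _)) // ler_sum // => i _.
  have iP := ltn_ord i; have /andP[ti it] := tag_in iP.
  have p0 := points_ge0 _ _ iP; have p1 := points_le1 _ _ iP.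
  have [] := @MVT_segment _ G g (0 :: points P)`_i (points P)`_i.
  - by rewrite (le_trans (ltW ti)) // ltW.
  - move=> x; rewrite in_itv /= => /andP[ix xi]; apply: G'.
    by apply/andP; split; lra.
  - apply: derivable_within_continuous => x; rewrite in_itv /= => /andP[ix xi].
    by apply: ex_derive; apply: G'; apply/andP; split; lra.
  move=> c; rewrite in_itv /= => /andP[ic ci] ->.
  rewrite [g c * _]mulrC -scalerBr normrZ gtr0_norm ?width_gt0 //.
  rewrite ler_pM2l ?width_gt0 // distrC ltW // gd //.
    by apply/andP; split; lra.
  have : width P i < d by apply: le_lt_trans Pd; exact: width_le_mesh.
  by rewrite /width => ?; rewrite ltr_norml; apply/andP; split; lra.
by rewrite -mulr_suml sum_width mul1r; lra.
Unshelve. all: by end_near. Qed.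

End RiemannSums.

Lemma eq_riemann_sum (R : realType) (Z : normedModType R) (f g : R -> Z)
    (P : tagged_partition R) :
  (forall x, 0 <= x <= 1 -> f x = g x) -> riemann_sum f P = riemann_sum g P.
Proof.
move=> fg; apply: eq_bigr => i _; rewrite fg //.
have iP := ltn_ord i; have /andP[ti it] := tag_in iP.
have p0 := points_ge0 _ _ iP; have p1 := points_le1 _ _ iP.
by apply/andP; split; lra.
Qed.

(** * Integrability after a Dunford-Pettis operator *)

(** Composing with the clamp onto [0, 1] gives a continuous scalar function on the line with the
    same Riemann sums. *)
Lemma weakly_continuous_scalarly_riemann_integrable (R : realType)
    (X : normedModType R) (f : R -> X) :
  weakly_continuous f -> scalarly_riemann_integrable f.
Proof.
move=> fc xs; pose clamp (x : R) : R := Num.max 0 (Num.min 1 x).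
have clampc : continuous clamp.
  move=> x; apply: continuous_max; first exact: cvg_cst.
  by apply: continuous_min; [exact: cvg_cst|exact: cvg_id].
have clamp01 x : `[0, 1]%classic (clamp x).
  by rewrite /= in_itv /= le_max lexx ge_max ler01 ge_min lexx.
have /continuous_riemann_integrable[z gz] : continuous (xs \o f \o clamp).
  move=> x; move/subspace_continuousP : fc => /(_ _ (clamp01 x)).
  move=> /cvg_weakP/(_ xs) fc.
  apply: cvg_comp fc => A /= /clampc[r r0 rA].
  by exists r => // y /rA; apply; exact: clamp01.
exists z => eps /gz[d d0 dP]; exists d => // P Pd.
rewrite (@eq_riemann_sum _ _ _ (xs \o f \o clamp)) ?dP // => x /andP[x0 x1] /=.
by rewrite /clamp min_r // max_r.
Qed.

Lemma dunford_pettis_riemann_integrable (R : realType) (X : normedModType R)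
    (Y : completeNormedModType R) (T : {linear X -> Y}) (f : R -> X) :
  dunford_pettis T -> scalarly_riemann_integrable f ->
  riemann_integrable (T \o f).
Proof.
move=> T_dp f_sri; apply: riemann_integrable_cauchy => eps eps0.
apply: contrapT => noC.
have /choice[PQ PQP] : forall n,
    exists PQ : tagged_partition R * tagged_partition R,
    [/\ mesh PQ.1 < n.+1%:R^-1, mesh PQ.2 < n.+1%:R^-1 &
     eps <= `|T (riemann_sum f PQ.1 - riemann_sum f PQ.2)|].
  move=> n; apply: contrapT => nPQ; apply: noC.
  exists n.+1%:R^-1 => [|P Q Pn Qn]; first by rewrite invr_gt0.
  rewrite !linear_riemann_sum -linearB ltNge; apply/negP => Teps.
  by apply: nPQ; exists (P, Q).
pose u n := riemann_sum f (PQ n).1 - riemann_sum f (PQ n).2.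
have u0 : weakly_cvg u 0.
  apply/cvg_weakP => xs; rewrite linear0; apply/cvgr0Pnorm_lt => e e0.
  have [z zP] := f_sri xs.
  have [d d0 dP] := zP (e / 2) (divr_gt0 e0 (ltr0Sn _ 1)).
  have [n nd] := ltr_add_invr d0; rewrite add0r in nd.
  exists n => // m /= nm.
  have md : m.+1%:R^-1 < d.
    by apply: le_lt_trans nd; rewrite lef_pV2 ?posrE ?ltr0n // ler_nat.
  have [Pm Qm _] := PQP m.
  rewrite linearB -!(linear_riemann_sum _ _ xs) -(subrKA z) (splitr e).
  rewrite (le_lt_trans (ler_normD _ _)) // ltrD //.
    by apply: dP; exact: lt_trans md.
  by rewrite distrC; apply: dP; exact: lt_trans md.
have /cvgr0Pnorm_lt/(_ _ eps0)[n _ /(_ n (leqnn n))] := T_dp _ u0.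
by rewrite /= ltNge; have [_ _ ->] := PQP n.
Qed.

(** * Weakly continuous functions from weakly null sequences *)

(** At each [t] at most one [phi n t *: u n] is nonzero. Under [xs] the terms of large index are
    uniformly small, so [xs \o f] is a uniform limit of continuous partial sums. *)
Lemma weakly_continuous_disjoint_sum (R : realType) (X : normedModType R)
    (u : nat -> X) (phi : nat -> R -> R) :
  weakly_cvg u 0 -> (forall n, continuous (phi n)) ->
  (forall n t, `|phi n t| <= 1) ->
  (forall m n t, phi m t != 0 -> phi n t != 0 -> m = n) ->
  exists f : R -> X, [/\ weakly_continuous f,
    forall n t, phi n t != 0 -> f t = phi n t *: u n &
    forall t, (forall n, phi n t = 0) -> f t = 0].
Proof.
move=> /cvg_weakP u0 phic phi1 phiD.
(* Where every [phi n] vanishes, the default index 0 still gives [f t = 0]. *)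
pose idx t := xget 0%N [set n | phi n t != 0].
pose f t := phi (idx t) t *: u (idx t).
have idxP n t : phi n t != 0 -> phi (idx t) t != 0.
  by move=> nt; exact: (xgetI 0%N (P := [set n | phi n t != 0]) nt).
have fE n t : phi n t != 0 -> f t = phi n t *: u n.
  by move=> nt; rewrite /f -(phiD _ _ _ nt (idxP _ _ nt)).
exists f; split=> [||t t0] //; last by rewrite /f t0 scale0r.
apply: continuous_subspaceT => x; apply/cvg_weakP => xs.
apply/cvgrPdist_lt => eps eps0.
have eps30 : 0 < eps / 3 by rewrite divr_gt0.
have := u0 xs; rewrite linear0 => /cvgr0Pnorm_lt/(_ _ eps30)[N _ uN].
pose g t : R := \sum_(n < N) phi n t * xs (u n).
have gf t : `|g t - xs (f t)| < eps / 3.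
  rewrite /f linearZ /=; have [t0|it] := eqVneq (phi (idx t) t) 0.
    rewrite t0 scale0r subr0 /g big1 ?normr0 // => n _.
    have [->|/idxP] := eqVneq (phi n t) 0; first by rewrite mul0r.
    by rewrite t0 eqxx.
  have phi0 n : n != idx t -> phi n t = 0.
    by move=> nt; apply: contra_neq_eq nt => nt; exact: phiD nt it.
  have [iN|Ni] := ltnP (idx t) N.
    rewrite /g (bigD1 (Ordinal iN)) //= big1 ?addr0 ?subrr ?normr0 // => n.
    by move=> nt; rewrite phi0 ?mul0r.
  rewrite /g big1 => [|n _]; last first.
    by rewrite phi0 ?mul0r // ltn_eqF // (leq_trans _ Ni).
  rewrite sub0r normrN normrZ; apply: le_lt_trans (uN _ Ni).
  by rewrite ler_piMl.
have gc : continuous g.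
  apply: continuous_big => [|n _ y]; first exact: add_continuous.
  by apply: cvgM; [exact: phic|exact: cvg_cst].
have /cvgrPdist_lt/(_ _ eps30) := gc x.
apply: filterS => t gt.
change (`|(xs (f x) : R) - xs (f t)| < eps).
move: (gf x) (gf t) gt; rewrite !ltr_norml.
by move=> /andP[? ?] /andP[? ?] /andP[? ?]; apply/andP; split; lra.
Qed.

(** * Counting the alive cells *)

(* Every one of the [cells n] equal cells of generation [n] is divided into
   [2 ^ n.+2] cells of the next one, and the first of these is a gap. The cell
   number [k] is alive when it lies in no earlier gap, i.e. when no digit of [k]
   in the mixed radix given by the [2 ^ m.+2] vanishes. *)
Fixpoint cells (n : nat) : nat :=
  if n is m.+1 then (cells m * 2 ^ m.+2)%N else 1%N.

Fixpoint alive (n k : nat) : bool :=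
  if n is m.+1 then alive m (k %/ 2 ^ m.+2) && (k %% 2 ^ m.+2 != 0)%N else true.

(** Makes the mesh [(cells n)%:R^-1] tend to 0. *)
Lemma cells_gt n : (n < cells n)%N.
Proof.
elim: n => //= n IH; rewrite expnS mulnCA mul2n.
have : (0 < 2 ^ n.+1)%N by rewrite expn_gt0.
by nia.
Qed.

Lemma dvdn_cells m n : (m <= n)%N -> (cells m %| cells n)%N.
Proof.
elim: n => [|n IH]; first by rewrite leqn0 => /eqP->.
rewrite leq_eqVlt => /predU1P[->//|]; rewrite ltnS => /IH mn.
by rewrite /= dvdn_mulr.
Qed.

(** An alive cell loses only its first child, the gap; a dead cell has no alive child. *)
Lemma card_alive_succ n : (\sum_(0 <= k < cells n.+1) alive n.+1 k =
  (\sum_(0 <= k < cells n) alive n k) * (2 ^ n.+2).-1)%N.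
Proof.
rewrite big_nat_mul big_distrl /=; apply: eq_bigr => k _.
set M := (2 ^ n.+2)%N; have M0 : (0 < M)%N by rewrite expn_gt0.
rewrite -[X in (\sum_(X <= _ < _) _)%N]add0n big_addn -mulnBl subSnn mul1n.
rewrite (@eq_big_nat _ _ _ _ _ _ (fun j => (alive n k && (j != 0)) : nat)).
  rewrite big_ltn // eqxx andbF add0n.
  rewrite (@eq_big_nat _ _ _ _ _ _ (fun=> alive n k : nat)).
    by rewrite sum_nat_const_nat subn1 mulnC.
  by move=> [|j] // _; rewrite andbT.
move=> j /andP[_ jM]; rewrite addnC divnMDl // divn_small // addn0.
by rewrite modnMDl modn_small.
Qed.

(* The alive proportion is the product of the [1 - 2 ^- m.+2], [m < n], bounded
   below by [1 / 2 + 2 ^- n.+1] rather than [1 / 2] for the induction. *)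
Lemma card_alive_ge n :
  ((2 ^ n).+1 * cells n <= 2 ^ n.+1 * \sum_(0 <= k < cells n) alive n k)%N.
Proof.
elim: n => [|n IH]; first by rewrite big_nat1.
rewrite card_alive_succ /=; set q := cells n in IH *.
set c := (\sum_(_ <= _ < _) _)%N in IH *.
rewrite !expnS in IH *; set p := (2 ^ n)%N in IH *.
have : (0 < p)%N by rewrite expn_gt0.
nia.
Qed.

(** * Tents on the gaps of the Cantor set *)

Section CantorBumps.
Context {R : realType}.

Definition tent (x : R) : R := Num.max 0 (1 - `|2 * x - 1|).

(** The argument of [tent] maps the gap in cell [k], which is cell [2 ^ n.+2 * k] of generation
    [n.+1], affinely onto [0, 1]. *)
Definition bump (n : nat) (t : R) : R :=
  \sum_(k < cells n | alive n k) tent ((cells n.+1)%:R * t - (2 ^ n.+2 * k)%:R).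

(** Truncation is the floor only for [0 <= t], hence the sign hypotheses below. *)
Definition cell (n : nat) (t : R) : nat := Num.trunc ((cells n)%:R * t).

Lemma tent_continuous : continuous tent.
Proof.
move=> x.
apply: (@continuous_max R R (fun=> 0) (fun x => 1 - `|2 * x - 1|)).
  exact: cvg_cst.
apply: cvgB; first exact: cvg_cst.
apply: (@cvg_norm _ R^o); apply: cvgB; last exact: cvg_cst.
by apply: cvgM; [exact: cvg_cst|exact: cvg_id].
Qed.

Lemma tent_le1 x : `|tent x| <= 1.
Proof.
rewrite ger0_norm ?le_max ?lexx // /tent ge_max ler01 /=.
by rewrite gerBl.
Qed.

Lemma tent_neq0 x : tent x != 0 -> 0 < x < 1.
Proof.
apply: contra_neqT => x01; apply/max_idPl; rewrite subr_le0.
move: x01; rewrite negb_and -!leNgt.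
by case/orP => ?; [rewrite ler0_norm|rewrite ger0_norm]; lra.
Qed.

Lemma tent_half : tent 2^-1 = 1.
Proof. by rewrite /tent divff // subrr normr0 subr0 max_r. Qed.

Lemma bump_continuous n : continuous (bump n).
Proof.
apply: continuous_big => [|k _ t]; first exact: add_continuous.
apply: (@continuous_comp R R R
  (fun t => (cells n.+1)%:R * t - (2 ^ n.+2 * k)%:R) tent); last first.
  exact: tent_continuous.
apply: cvgB; last exact: cvg_cst.
by apply: cvgM; [exact: cvg_cst|exact: cvg_id].
Qed.

Lemma cells_gt0 n : 0 < (cells n)%:R :> R.
Proof. by rewrite ltr0n; apply: leq_ltn_trans (cells_gt n). Qed.

(** The integer part of [x / M] is the integer quotient by [M] of the integer part of [x]. *)
Lemma cell_div n t : 0 <= t -> (cell n.+1 t %/ 2 ^ n.+2)%N = cell n t.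
Proof.
move=> t0; apply/esym/trunc_def.
have M0 : 0 < (2 ^ n.+2)%:R :> R by rewrite ltr0n expn_gt0.
have /trunc_itv/andP[] : 0 <= (cells n.+1)%:R * t by rewrite mulr_ge0.
rewrite -/(cell n.+1 t); set c := cell n.+1 t.
rewrite [cells n.+1]/= natrM mulrAC => ct tc; apply/andP; split.
  rewrite -(ler_pM2r M0) (le_trans _ ct) // -natrM ler_nat.
  exact: leq_divM.
rewrite -(ltr_pM2r M0) (lt_le_trans tc) // -natrM ler_nat.
by rewrite -ltn_divLR ?expn_gt0.
Qed.

(** Turns supports into cell numbers, so that disjointness becomes integer arithmetic. *)
Lemma tent_cell n k t :
  tent ((cells n.+1)%:R * t - (2 ^ n.+2 * k)%:R) != 0 ->
  [/\ 0 < t, cell n.+1 t = (2 ^ n.+2 * k)%N & cell n t = k].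
Proof.
move=> /tent_neq0/andP[t0 t1].
have M0 : (0 < 2 ^ n.+2)%N by rewrite expn_gt0.
have tgt0 : 0 < t.
  rewrite -(pmulr_rgt0 _ (cells_gt0 n.+1)).
  by apply: le_lt_trans (_ : (2 ^ n.+2 * k)%:R < _); rewrite // -subr_gt0.
have E : cell n.+1 t = (2 ^ n.+2 * k)%N.
  by apply: trunc_def; rewrite -natr1; apply/andP; split; lra.
by split=> //; rewrite -cell_div ?ltW // E mulKn.
Qed.

Lemma bump_cell n k t : (k < cells n)%N -> alive n k ->
  tent ((cells n.+1)%:R * t - (2 ^ n.+2 * k)%:R) != 0 ->
  bump n t = tent ((cells n.+1)%:R * t - (2 ^ n.+2 * k)%:R).
Proof.
move=> kn ak tk; rewrite /bump (bigD1 (Ordinal kn)) //= big1 ?addr0 // => i.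
move=> /andP[_]; apply: contra_neq_eq => /tent_cell[_ _ ik].
by apply: val_inj; rewrite /= -ik; have [] := tent_cell _ _ _ tk.
Qed.

Lemma bump_neq0 n t : bump n t != 0 ->
  exists k, [/\ (k < cells n)%N, alive n k &
    tent ((cells n.+1)%:R * t - (2 ^ n.+2 * k)%:R) != 0].
Proof.
move=> bt; apply: contrapT => nk; move/negP: bt; apply; apply/eqP.
rewrite /bump big1 // => k ak; apply/eqP; apply: contrapT => /negP tk.
by apply: nk; exists k.
Qed.

Lemma bump_le1 n t : `|bump n t| <= 1.
Proof.
have [->|/bump_neq0[k [kn ak tk]]] := eqVneq (bump n t) 0.
  by rewrite normr0.
by rewrite (bump_cell _ _ _ kn ak tk) tent_le1.
Qed.

Lemma alive_cell m n t : 0 <= t -> (m <= n)%N ->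
  alive n (cell n t) -> alive m (cell m t).
Proof.
move=> t0; elim: n => [|n IH]; first by rewrite leqn0 => /eqP->.
rewrite leq_eqVlt => /predU1P[->//|]; rewrite ltnS => /IH mn.
by rewrite [alive n.+1 _]/= cell_div // => /andP[/mn].
Qed.

(** In a gap of generation [m] the cell number of generation [m.+1] is divisible by [2 ^ m.+2], so
    that cell and all cells within it are dead. *)
Lemma bump_dead m n t : bump m t != 0 -> (m < n)%N -> ~~ alive n (cell n t).
Proof.
move=> /bump_neq0[k [_ _ /tent_cell[t0 mk _]]] mn.
apply/negP => /(alive_cell _ _ _ (ltW t0) mn) /=.
by rewrite mk modnMr eqxx andbF.
Qed.

Lemma bump_disjoint m n t : bump m t != 0 -> bump n t != 0 -> m = n.
Proof.
wlog mn : m n / (m <= n)%N.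
  by move=> H a b; have [/H|/ltnW/H h] := leqP m n; [exact|exact/esym/h].
move=> bm bn; move: mn; rewrite leq_eqVlt => /predU1P[//|].
move=> /(bump_dead _ _ _ bm).
by have [k [_ ak /tent_cell[_ _ ->]]] := bump_neq0 _ _ bn; rewrite ak.
Qed.

(** The gap fills the first [1 / 2 ^ n.+2] of its cell, so the point is its centre. *)
Lemma bump_mid n k : (k < cells n)%N -> alive n k ->
  bump n ((k%:R + (2 * 2 ^ n.+2)%:R^-1) / (cells n)%:R) = 1.
Proof.
move=> kn ak; set t := _ / _.
have E : (cells n.+1)%:R * t - (2 ^ n.+2 * k)%:R = 2^-1.
  have q0 : (cells n)%:R != 0 :> R by rewrite gt_eqF // cells_gt0.
  have M0 : (2 ^ n.+2)%:R != 0 :> R by rewrite pnatr_eq0 -lt0n expn_gt0.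
  rewrite /t [cells n.+1]/=; move: (2 ^ n.+2)%N M0 => M M0.
  by rewrite !natrM; field; rewrite q0.
by rewrite (bump_cell _ _ _ kn ak) E tent_half ?oner_neq0.
Qed.

(* The right end of a gap is a grid point of every later generation, and the
   tents of later generations vanish there. *)
Lemma bump_end m n k : alive n k ->
  bump m ((k%:R + (2 ^ n.+2)%:R^-1) / (cells n)%:R) = 0.
Proof.
move=> ak; set t := _ / _; apply/eqP; apply/negP => /negP tm.
have q0 := cells_gt0 n.
have E : (cells n.+1)%:R * t = (k * 2 ^ n.+2 + 1)%:R.
  have M0 : (2 ^ n.+2)%:R != 0 :> R by rewrite pnatr_eq0 -lt0n expn_gt0.
  rewrite /t [cells n.+1]/=; move: (2 ^ n.+2)%N M0 => M M0.
  by rewrite natrD !natrM; field; rewrite M0 gt_eqF.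
(* A nonzero bump of an earlier generation would make the cell of [t] in generation [n] dead, but
   that cell is [k]. *)
have [mn|nm] := ltnP m n.
  have /negP := bump_dead _ _ _ tm mn; apply.
  suff -> : cell n t = k by [].
  rewrite -cell_div; last first.
    by rewrite /t divr_ge0 ?addr_ge0 ?invr_ge0 // ltW.
  have -> : cell n.+1 t = (k * 2 ^ n.+2 + 1)%N.
    by apply: trunc_def; rewrite E lexx ltr_nat /=.
  by rewrite divnMDl ?expn_gt0 // divn_small ?addn0 // -{1}(expn0 2) ltn_exp2l.
(* For [n <= m], [(cells m.+1)%:R * t] is an integer, and a nonzero tent would place it strictly
   between consecutive integers. *)
have [j [_ _ /tent_neq0]] := bump_neq0 _ _ tm.
have /dvdnP[p ->] := dvdn_cells _ _ (nm : (n.+1 <= m.+1)%N).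
rewrite natrM -mulrA E -natrM subr_gt0 ltr_nat => /andP[jp].
by rewrite ltrBlDr -[1]/(1%:R) -natrD ltr_nat add1n ltnS leqNgt jp.
Qed.

End CantorBumps.

(** * Necessity of the Dunford-Pettis property, and the equivalence *)

Lemma riemann_integrable_dunford_pettis (R : realType) (X Y : normedModType R)
    (T : {linear X -> Y}) :
  (forall f : R -> X, weakly_continuous f -> riemann_integrable (T \o f)) ->
  dunford_pettis T.
Proof.
move=> T_ri u u0.
have [f [fc fE f0]] := weakly_continuous_disjoint_sum _ _ _ _ u0
  (@bump_continuous R) bump_le1 bump_disjoint.
have [z zP] := T_ri f fc.
apply/cvgr0Pnorm_lt => eps eps0.
(* The two sums differ by less than [eps / 2], and the coefficient of [u n] is at least 1/2. *)
have [d d0 dP] := zP (eps / 4) (divr_gt0 eps0 (ltr0Sn _ 3)).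
have [N Nd] := ltr_add_invr d0; rewrite add0r in Nd.
exists N => // n /= Nn.
have q0 := @cells_gt0 R n; have q0' : (0 < cells n)%N by rewrite -(ltr0n R).
pose M : R := (2 ^ n.+2)%:R.
have M4 : 4 <= M.
  by rewrite ler_nat -[4%N]/(2 ^ 2)%N leq_exp2l.
have Mi : 0 < M^-1 <= 4^-1.
  by rewrite invr_gt0 lef_pV2 ?posrE ?M4 ?andbT; lra.
(* Relative tag position [a] in alive cells and [b] in dead ones; both partitions take [b] to be
   1/2, so dead cells cancel in the difference. *)
pose t (a b : R) k : R := (k%:R + (if alive n k then a else b)) / (cells n)%:R.
have tP a k : 0 < a < 1 ->
    k%:R / (cells n)%:R < t a 2^-1 k < k.+1%:R / (cells n)%:R.
  move=> a01; rewrite /t !ltr_pM2r ?invr_gt0 // -[k.+1%:R]natr1.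
  by case: ifP => _; lra.
have [|P [Pq PE]] := uniform_partition_exists _ (t (2 * M)^-1 2^-1) q0'.
  move=> k _; apply: tP; rewrite invfM; lra.
have [|Q [Qq QE]] := uniform_partition_exists _ (t M^-1 2^-1) q0'.
  move=> k _; apply: tP; lra.
have qd : (cells n)%:R^-1 < d.
  apply: le_lt_trans Nd; rewrite lef_pV2 ?posrE ?ltr0n // ler_nat.
  exact: leq_ltn_trans Nn (cells_gt n).
have PQ : riemann_sum f P - riemann_sum f Q =
    ((\sum_(0 <= k < cells n) alive n k)%:R / (cells n)%:R) *: u n.
  rewrite PE QE -scalerBr -sumrB [in RHS]mulrC -scalerA; congr (_ *: _).
  rewrite big_mkord natr_sum scaler_suml; apply: eq_bigr => k _.
  rewrite /t; case: ifP => ak; last by rewrite subrr scale0r.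
  rewrite [f (_ / _) in X in _ - X]f0 => [|m]; last exact: bump_end.
  have b1 := bump_mid _ _ (ltn_ord k) ak.
  rewrite -natrM (fE n); first by rewrite b1 subr0.
  by rewrite b1 oner_neq0.
have half : 2^-1 <= (\sum_(0 <= k < cells n) alive n k)%:R / (cells n)%:R :> R.
  rewrite ler_pdivlMr // mulrC ler_pdivrMr // -natrM ler_nat.
  have := card_alive_ge n; rewrite expnS; set c := (\sum_(_ <= _ < _) _)%N.
  move: (2 ^ n)%N (expn_gt0 2 n) => p /= p0 H.
  by rewrite -(leq_pmul2l p0); lia.
have : `|T (riemann_sum f P - riemann_sum f Q)| < eps / 2.
  rewrite linearB -!(linear_riemann_sum _ _ T) -(subrKA z).
  have -> : eps / 2 = eps / 4 + eps / 4 by lra.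
  rewrite (le_lt_trans (ler_normD _ _)) // ltrD //.
    by apply: dP; exact: le_lt_trans qd.
  by rewrite distrC; apply: dP; exact: le_lt_trans qd.
rewrite PQ linearZ normrZ ger0_norm; last by lra.
move=> h; have := ler_wpM2r (normr_ge0 (T (u n))) half.
by rewrite /=; lra.
Qed.

Theorem corollary3p6 (R : realType) (X Y : completeNormedModType R)
    (T : {linear X -> Y}) (T_cont : continuous T) :
  [<-> dunford_pettis T;
       forall f : R -> X, weakly_continuous f -> riemann_integrable (T \o f);
       forall f : R -> X, scalarly_riemann_integrable f ->
         riemann_integrable (T \o f)].
Proof.
(* Around the cycle, the second statement gives the third through the first, and the third gives the
   first through the second. *)
tfae=> [T_dp f f_wc|T_wc f f_sri|T_sri].
- apply: dunford_pettis_riemann_integrable T_dp _.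
  exact: weakly_continuous_scalarly_riemann_integrable.
- apply: dunford_pettis_riemann_integrable f_sri.
  exact: riemann_integrable_dunford_pettis.
- apply: riemann_integrable_dunford_pettis => f f_wc; apply: T_sri.
  exact: weakly_continuous_scalarly_riemann_integrable.
Qed.
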